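(* Fix a measurable $f:\Omega\to[0,\infty]$. Then $J_f$ is a positive definite kernel on $X_f$. More precisely, for every $r\ge1$ and every $s_1,\dots,s_r\in X_f$, the Gram matrix $[J_f(s_i,s_j)]_{i,j=1}^r$ is positive semidefinite.
   Context: Let $X$ be a set, $m\ge1$ an integer, and $\varphi_1,\dots,\varphi_m:X\to X$ maps. A kernel $J:Y\times Y\to\mathbb{C}$ is positive definite if $\sum_{\alpha,\beta}\overline{c_\alpha}c_\beta J(s_\alpha,s_\beta)\ge0$ for all finite families $(c_\alpha,s_\alpha)\in\mathbb{C}\times Y$; $J_1\le J_2$ means that $J_2-J_1$ is positive definite. The pullback operator is $(LJ)(s,t):=\sum_{i=1}^m J(\varphi_i(s),\varphi_i(t))$. Fix a positive definite kernel $K$ on $X$ with $LK\ge K$. Set $K_0:=K$, $K_{n+1}:=LK_n$, $u_n(s):=K_n(s,s)$ (nondecreasing in $n$), $u_\infty(s):=\lim_nu_n(s)\in[0,\infty]$, $X_{\mathrm{fin}}:=\{s\in X:u_\infty(s)<\infty\}$. Each $\varphi_i$ maps $X_{\mathrm{fin}}$ into itself. For $s,t\in X_{\mathrm{fin}}$ the limit $K_\infty(s,t):=\lim_nK_n(s,t)$ exists; $K_\infty$ is positive definite on $X_{\mathrm{fin}}$ and $LK_\infty=K_\infty$ there; $K_\infty(s,s)=u_\infty(s)$. Words: $W_n:=\{1,\dots,m\}^n$, $W_0=\{\emptyset\}$; for $w=i_1\cdots i_n\in W_n$, $\varphi_w:=\varphi_{i_n}\circ\cdots\circ\varphi_{i_1}$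 ($\varphi_\emptyset=\mathrm{id}$). $\Omega:=\{1,\dots,m\}^{\mathbb{N}}$ with product $\sigma$-algebra and product probability measure $\mu$ making the coordinates independent and uniform on $\{1,\dots,m\}$. For $\omega=\omega_1\omega_2\cdots\in\Omega$, $\omega|n:=\omega_1\cdots\omega_n\in W_n$ ($\omega|0=\emptyset$). For $s,t\in X_{\mathrm{fin}}$, $M_n(s,t;\omega):=m^nK_\infty(\varphi_{\omega|n}(s),\varphi_{\omega|n}(t))$. For $s\in X_{\mathrm{fin}}$ let $B(s):=\sup_{n\ge0}\{m^n\sum_{w\in W_n}u_\infty(\varphi_w(s))^2\}\in[0,\infty]$, and $X_2:=\{s\in X_{\mathrm{fin}}:B(s)<\infty\}$. For $s,t\in X_2$, $M_n(s,t;\cdot)$ converges in $L^2(\Omega,\mu)$ and $\mu$-almost surely; $M_\infty(s,t;\cdot)\in L^2(\Omega,\mu)$ denotes (a fixed measurable version of) the limit, with $M_\infty(s,s;\cdot)\ge0$; $h(s;\omega):=M_\infty(s,s;\omega)\in[0,\infty)$. For measurable $f:\Omega\to[0,\infty]$ let $X_f:=\{s\in X_2:\int_\Omega f(\omega)h(s;\omega)\,d\mu(\omega)<\infty\}$ and, for $s,t\in X_f$, $J_f(s,t):=\int_\Omega f(\omega)M_\infty(s,t;\omega)\,d\mu(\omega)$, with the convention $\infty\cdot0=0$; this integral converges absolutely for $s,t\in X_f$ (because $|M_\infty(s,t;\cdot)|^2\le h(s;\cdot)h(t;\cdot)$ $\mu$-a.s.). *)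

(* Defs.v *)
From HB Require Import structures.
From mathcomp Require Import all_boot all_order all_algebra.
From mathcomp Require Import sesquilinear spectral.
From mathcomp Require Import all_classical all_reals all_analysis.
From mathcomp Require Import measurable_realfun.
From mathcomp Require Import complex.

Set Implicit Arguments.
Unset Strict Implicit.
Unset Printing Implicit Defensive.

Import Order.TTheory GRing.Theory Num.Theory.
Import numFieldNormedType.Exports.

Local Open Scope classical_set_scope.
Local Open Scope complex_scope.
Local Open Scope ring_scope.

(* The order of R[i] is the partial one: 0 <= z means that z is real and
   nonnegative. *)
Definition posdef_on (R : realType) (X : Type) (A : set X)
    (J : X -> X -> R[i]) : Prop :=
  forall (n : nat) (c : 'I_n -> R[i]) (s : 'I_n -> X), (forall a, A (s a)) ->
    0 <= \sum_(a < n) \sum_(b < n) Num.conj (c a) * c b * J (s a) (s b).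

Definition posdef (R : realType) (X : Type) (J : X -> X -> R[i]) : Prop :=
  posdef_on setT J.

Definition kernel_le (R : realType) (X : Type) (J1 J2 : X -> X -> R[i]) : Prop :=
  posdef (fun s t => J2 s t - J1 s t).

Definition psdmx (R : realType) (r : nat) (A : 'M[R[i]]_r) : Prop :=
  A \is hermsymmx /\
  forall v : 'cV[R[i]]_r, 0 <= ((map_mx Num.conj v)^T *m A *m v) 0 0.

(* From here on the number of maps is m.+1, so that it is at least 1 and the
   alphabet 'I_m.+1 is inhabited. *)

Definition pullback (R : realType) (X : Type) (m : nat)
    (phi : 'I_m.+1 -> X -> X) (J : X -> X -> R[i]) : X -> X -> R[i] :=
  fun s t => \sum_(i < m.+1) J (phi i s) (phi i t).

Definition Kseq (R : realType) (X : Type) (m : nat) (phi : 'I_m.+1 -> X -> X)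
    (K : X -> X -> R[i]) (n : nat) : X -> X -> R[i] :=
  iter n (pullback phi) K.

(* The diagonal of a positive definite kernel is real, so nothing is lost by
   taking real parts. *)
Definition useq (R : realType) (X : Type) (m : nat) (phi : 'I_m.+1 -> X -> X)
    (K : X -> X -> R[i]) (n : nat) (s : X) : R :=
  complex.Re (Kseq phi K n s s).

Definition uinf (R : realType) (X : Type) (m : nat) (phi : 'I_m.+1 -> X -> X)
    (K : X -> X -> R[i]) (s : X) : \bar R :=
  limn (fun n => (useq phi K n s)%:E).

Definition Xfin (R : realType) (X : Type) (m : nat) (phi : 'I_m.+1 -> X -> X)
    (K : X -> X -> R[i]) : set X :=
  [set s | (uinf phi K s < +oo)%E].

(* The topology of the complex field is carried by R[i]^o. Only the values on
   Xfin are meaningful. *)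
Definition Kinf (R : realType) (X : Type) (m : nat) (phi : 'I_m.+1 -> X -> X)
    (K : X -> X -> R[i]) (s t : X) : R[i] :=
  limn ((fun n => Kseq phi K n s t) : nat -> R[i]^o).

(* phi_w = phi_(i_n) \o ... \o phi_(i_1): the first letter acts first. *)
Definition phi_word (X : Type) (m : nat) (phi : 'I_m.+1 -> X -> X)
    (w : seq 'I_m.+1) (s : X) : X :=
  foldl (fun x i => phi i x) s w.

(* The infinite product of discrete spaces, generated by the coordinates. *)
Definition coord_events (m : nat) : set (set (nat -> 'I_m.+1)) :=
  [set A | exists (k : nat) (B : set 'I_m.+1), A = [set w | B (w k)]].

(* Measurable types are pointed in the library. *)
HB.instance Definition _ (m : nat) := isPointed.Build 'I_m.+1 ord0.

Notation Omega m := (g_sigma_algebraType (@coord_events m)).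

(* This determines mu: the rectangles generate the product sigma-algebra and
   are stable under finite intersections. *)
Definition is_uniform_product (R : realType) (m : nat)
    (mu : probability (Omega m) R) : Prop :=
  forall (n : nat) (A : nat -> {set 'I_m.+1}),
    mu [set w : Omega m | forall k, (k < n)%N -> w k \in A k] =
    (\prod_(k < n) (#|A k|%:R / m.+1%:R))%:E.

Definition Mseq (R : realType) (X : Type) (m : nat) (phi : 'I_m.+1 -> X -> X)
    (K : X -> X -> R[i]) (n : nat) (s t : X) (w : Omega m) : R[i] :=
  m.+1%:R ^+ n *
  Kinf phi K (phi_word phi (mkseq w n) s) (phi_word phi (mkseq w n) t).

Definition Bsup (R : realType) (X : Type) (m : nat) (phi : 'I_m.+1 -> X -> X)
    (K : X -> X -> R[i]) (s : X) : \bar R :=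
  ereal_sup (range (fun n : nat =>
    ((m.+1%:R ^+ n)%:E *
     \sum_(w : n.-tuple 'I_m.+1) uinf phi K (phi_word phi w s) ^+ 2)%E)).

Definition X2 (R : realType) (X : Type) (m : nat) (phi : 'I_m.+1 -> X -> X)
    (K : X -> X -> R[i]) : set X :=
  [set s | Xfin phi K s /\ (Bsup phi K s < +oo)%E].

Definition measurable_complex (R : realType) (m : nat) (F : Omega m -> R[i]) :
    Prop :=
  measurable_fun setT (fun w => complex.Re (F w)) /\
  measurable_fun setT (fun w => complex.Im (F w)).

Definition sq_L2norm (R : realType) (m : nat) (mu : probability (Omega m) R)
    (F : Omega m -> R[i]) : \bar R :=
  (\int[mu]_w ((Normc.normc (F w) ^+ 2)%R)%:E)%E.

(* Minf is a measurable version of the limit of the Mseq, with nonnegative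
   diagonal; its values outside X2 are irrelevant. *)
Definition is_limit_version (R : realType) (X : Type) (m : nat)
    (phi : 'I_m.+1 -> X -> X) (K : X -> X -> R[i])
    (mu : probability (Omega m) R) (Minf : X -> X -> Omega m -> R[i]) : Prop :=
  (forall s t, X2 phi K s -> X2 phi K t ->
    [/\ measurable_complex (Minf s t),
        (sq_L2norm mu (Minf s t) < +oo)%E,
        (fun n => sq_L2norm mu (fun w => Mseq phi K n s t w - Minf s t w))
          @ \oo --> 0%E &
        {ae mu, forall w : Omega m,
          ((fun n => Mseq phi K n s t w) : nat -> R[i]^o) @ \oo
            --> (Minf s t w : R[i]^o)}]) /\
  (forall s w, X2 phi K s -> 0 <= Minf s s w).

(* In MathComp-Analysis +oo * 0 = 0, as required for the integrands below. *)
Definition Xf (R : realType) (X : Type) (m : nat) (phi : 'I_m.+1 -> X -> X)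
    (K : X -> X -> R[i]) (mu : probability (Omega m) R)
    (Minf : X -> X -> Omega m -> R[i]) (f : Omega m -> \bar R) : set X :=
  [set s | X2 phi K s /\
     (\int[mu]_w (f w * (complex.Re (Minf s s w))%:E) < +oo)%E].

(* Integral of an [0, +oo]-valued weight times a complex function, taken on
   real and imaginary parts; meaningful when it converges absolutely. *)
Definition complex_integral (R : realType) (m : nat)
    (mu : probability (Omega m) R) (f : Omega m -> \bar R)
    (F : Omega m -> R[i]) : R[i] :=
  fine (\int[mu]_w (f w * (complex.Re (F w))%:E))%E +i*
  fine (\int[mu]_w (f w * (complex.Im (F w))%:E))%E.

Definition Jf (R : realType) (X : Type) (m : nat)
    (mu : probability (Omega m) R) (Minf : X -> X -> Omega m -> R[i])
    (f : Omega m -> \bar R) (s t : X) : R[i] :=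
  complex_integral mu f (Minf s t).

(* Main.v *)
Require Import Defs.
From HB Require Import structures.
From mathcomp Require Import all_boot all_order all_algebra.
From mathcomp Require Import sesquilinear spectral.
From mathcomp Require Import all_classical all_reals all_analysis.
From mathcomp Require Import measurable_realfun.
From mathcomp Require Import complex.
From mathcomp Require Import ring lra.
Import Order.TTheory GRing.Theory Num.Theory.
Import numFieldNormedType.Exports.
Local Open Scope classical_set_scope.
Local Open Scope ring_scope.

(** Positivity is lost nowhere along the chain K, K_n, K_oo, M_n, M_oo, J_f.

    The pullback preserves positive definiteness, so every K_n is positive
    definite and, since LK >= K, the differences K_(n+1) - K_n are too. By
    polarization the off-diagonal entries of a positive definite kernel are
    dominated by its diagonal ([posdef_on_polar]); applied to K_n and to
    K_(n+1) - K_n this makes K_n(s,t) converge as soon as K_n(s,s) and K_n(t,t)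
    are bounded ([Kseq_cvg]). A pointwise limit of positive definite kernels is
    positive definite ([posdef_on_lim]), hence K_oo is positive definite on
    X_fin; as X_fin is stable under the maps, M_n(.,.;w) is, for every w, a
    nonnegative multiple of K_oo read along the word w|n, and is positive
    definite on X_fin as well.

    For finitely many points s_1, ..., s_r of X_2, only finitely many a.s.
    convergences M_n(s_i,s_j;w) --> M_oo(s_i,s_j;w) are involved; on the event
    where all of them hold the matrix [M_oo(s_i,s_j;w)] is a limit of positive
    semidefinite ones ([Minf_posdef]). It remains to integrate this against f.
    The quadratic form of J_f is the integral of f times the quadratic form of
    M_oo, which is nonnegative a.s.; exchanging the finite sum and the integral
    requires some care because f may take the value +oo. But
    f h(s_i;.) is integrable, so that h(s_i;w) = 0 for almost every w with
    f(w) = +oo, and by polarization every M_oo(s_i,s_j;w) vanishes there too: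
    f may be replaced by its finite part ([dominated_weight]), and the
    integral is then linear ([posdef_complex_integral]). *)

Section proof.
Set Implicit Arguments.
Unset Strict Implicit.
Local Open Scope complex_scope.

(** * Positive definite kernels on a set *)

Lemma conjCcE (R : realType) (x : R[i]) : Num.conj x = (x^*)%C.
Proof. reflexivity. Qed.

Lemma posdef_on2 (R : realType) (X : Type) (A : set X) (J : X -> X -> R[i])
    (s t : X) (c d : R[i]) : posdef_on A J -> A s -> A t ->
  0 <= Num.conj c * c * J s s + Num.conj c * d * J s t +
       (Num.conj d * c * J t s + Num.conj d * d * J t t).
Proof.
move=> JA As At.
have := JA 2%N (fun a => if a == ord0 then c else d)
  (fun a => if a == ord0 then s else t).
rewrite !big_ord_recl !big_ord0 /= !addr0; apply => a.
by case: ifP.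
Qed.

Lemma posdef_on_ge0 (R : realType) (X : Type) (A : set X) (J : X -> X -> R[i])
    (s : X) : posdef_on A J -> A s -> 0 <= J s s.
Proof.
move=> JA As; have := posdef_on2 1 0 JA As As.
by rewrite rmorph1 rmorph0 !mul0r !mul1r !mul0r !addr0.
Qed.

(** The quadratic form is real at the coefficients (1, 1) and (1, i), which
    determines the imaginary and real parts of J s t - conj (J t s). *)
Lemma posdef_on_conj (R : realType) (X : Type) (A : set X) (J : X -> X -> R[i])
    (s t : X) : posdef_on A J -> A s -> A t -> J t s = Num.conj (J s t).
Proof.
move=> JA As At.
have := posdef_on2 1 1 JA As At; have := posdef_on2 1 'i JA As At.
have := posdef_on_ge0 JA As; have := posdef_on_ge0 JA At.
rewrite !conjCcE.
case: (J s s) (J s t) (J t s) (J t t) => [a b] [c d] [e f] [g h].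
rewrite !lecE /=.
move=> /andP[/eqP h0 _] /andP[/eqP b0 _] /andP[/eqP E1 _] /andP[/eqP E2 _].
by congr Complex; lra.
Qed.

(** Polarization: the quadratic form is nonnegative at the coefficients
    (1, u) for u = 1, -1, i, -i. The bound is linear in the diagonal, unlike
    that of the Cauchy-Schwarz inequality: for K_(n+1) - K_n it telescopes in n,
    and it is integrable against f as soon as the diagonal is. *)
Lemma posdef_on_polar (R : realType) (X : Type) (A : set X) (J : X -> X -> R[i])
    (s t : X) : posdef_on A J -> A s -> A t ->
  `|complex.Re (J s t)| <= (complex.Re (J s s) + complex.Re (J t t)) / 2 /\
  `|complex.Im (J s t)| <= (complex.Re (J s s) + complex.Re (J t t)) / 2.
Proof.
move=> JA As At.
have := posdef_on2 1 1 JA As At; have := posdef_on2 1 (-1) JA As At.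
have := posdef_on2 1 'i JA As At; have := posdef_on2 1 (- 'i) JA As At.
rewrite (posdef_on_conj JA As At) !conjCcE.
case: (J s s) (J s t) (J t t) => [a b] [c d] [e f].
rewrite !lecE /=.
move=> /andP[_ E1] /andP[_ E2] /andP[_ E3] /andP[_ E4].
by split; rewrite ler_norml; lra.
Qed.

(** Reindexing by an ordinal makes positive definiteness on a subset a
    statement about everywhere defined kernels, to which results that hold at
    almost every w for finitely many fixed points can be applied. *)
Lemma posdef_on_ord (R : realType) (X : Type) (A : set X) (J : X -> X -> R[i]) :
  posdef_on A J <-> forall (n : nat) (s : 'I_n -> X), (forall a, A (s a)) ->
    posdef (fun a b => J (s a) (s b)).
Proof.
split=> [JA n s As k c t _|JA n c s As]; first by apply: JA => a; exact: As.
exact: (JA n s As n c id).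
Qed.

(** Over the complex numbers, positivity of the quadratic form already forces
    the Gram matrix to be hermitian ([posdef_on_conj]). *)
Lemma posdef_on_psdmx (R : realType) (X : Type) (A : set X) (J : X -> X -> R[i])
    (r : nat) (s : 'I_r -> X) : posdef_on A J -> (forall a, A (s a)) ->
  psdmx (\matrix_(i < r, j < r) J (s i) (s j)).
Proof.
move=> JA As; split.
  apply/is_hermitianmxP/matrixP => i j; rewrite expr0 scale1r !mxE.
  exact: (posdef_on_conj JA).
move=> v; rewrite mxE.
have := JA r (fun i => v i 0) s As; congr (0 <= _).
under [RHS]eq_bigr do rewrite mxE mulr_suml.
rewrite exchange_big/=; apply: eq_bigr => i _; apply: eq_bigr => j _.
by rewrite !mxE mulrAC.
Qed.

(** * Limits of complex sequences and of positive definite kernels *)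

(** The topology of R[i]^o comes from the complex modulus, with radii in R[i];
    this reduces it to the real topology of the two coordinates. *)
Lemma cvg_complexE (R : realType) (u : nat -> R[i]) (l : R[i]) :
  ((u : nat -> R[i]^o) @ \oo --> (l : R[i]^o)) <->
  ((fun n => complex.Re (u n)) @ \oo --> complex.Re l) /\
  ((fun n => complex.Im (u n)) @ \oo --> complex.Im l).
Proof.
split.
- move=> /cvgrPdist_lt ul; split; apply/cvgrPdist_lt => e e0.
  + have e0' : 0 < e%:C%C by rewrite ltcR.
    have := ul _ e0'; apply: filterS => n un.
    rewrite -ltcR; apply: le_lt_trans un.
    by rewrite -raddfB normc_ge_Re.
  + have e0' : 0 < e%:C%C by rewrite ltcR.
    have := ul _ e0'; apply: filterS => n un.
    rewrite -ltcR; apply: le_lt_trans un.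
    by rewrite -raddfB normc_def lecR -sqrtr_sqr ler_wsqrtr// lerDr sqr_ge0.
- move=> [/cvgrPdist_lt ure /cvgrPdist_lt uim]; apply/cvgrPdist_lt => e e0.
  have [r r0 er] : exists2 r : R, 0 < r & e = r%:C%C.
    by move: e e0 => [a b]; rewrite ltcE /= => /andP[/eqP-> a0]; exists a.
  have r2 : 0 < r / 2 by rewrite divr_gt0.
  near=> n.
  have hre : `|complex.Re l - complex.Re (u n)| < r / 2.
    by near: n; exact: ure.
  have him : `|complex.Im l - complex.Im (u n)| < r / 2.
    by near: n; exact: uim.
  rewrite er; set z := (l : R[i]) - u n.
  change (`|z| < r%:C%C).
  rewrite normc_def ltcR -[ltRHS]gtr0_norm// -sqrtr_sqr ltr_sqrt ?exprn_gt0//.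
  move: hre him; rewrite -!raddfB -/z !ltr_norml => /andP[h1 h2] /andP[h3 h4].
  by nra.
Unshelve. all: by end_near. Qed.

Lemma cvg_complex_sum (R : realType) (I : Type) (r : seq I) (u : I -> nat -> R[i])
    (l : I -> R[i]) :
  (forall i, (u i : nat -> R[i]^o) @ \oo --> (l i : R[i]^o)) ->
  ((fun n => \sum_(i <- r) u i n) : nat -> R[i]^o) @ \oo
    --> (\sum_(i <- r) l i : R[i]^o).
Proof.
move=> ul; elim: r => [|i r IH].
  by rewrite big_nil; under eq_fun do rewrite big_nil; exact: cvg_cst.
by rewrite big_cons; under eq_fun do rewrite big_cons; exact: (cvgD (ul i) IH).
Qed.

Lemma cvg_complex_ge0 (R : realType) (u : nat -> R[i]) (l : R[i]) :
  (forall n, 0 <= u n) -> ((u : nat -> R[i]^o) @ \oo --> (l : R[i]^o)) -> 0 <= l.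
Proof.
move=> u0 /cvg_complexE[ure uim]; rewrite lecE /=; apply/andP; split.
  have : (fun=> 0 : R) @ \oo --> complex.Im l.
    by apply: cvg_trans uim; apply: near_eq_cvg; near=> n; rewrite ger0_Im.
  by move=> /(cvg_unique _ (@cvg_cst _ _ _ _ _)) <-.
rewrite -(cvg_lim _ ure)//; apply: limr_ge; first by apply/cvg_ex; eexists; exact: ure.
by near=> n; have := u0 n; rewrite lecE => /andP[].
Unshelve. all: by end_near. Qed.

Lemma posdef_on_lim (R : realType) (X : Type) (A : set X)
    (Jn : nat -> X -> X -> R[i]) (J : X -> X -> R[i]) :
  (forall n, posdef_on A (Jn n)) ->
  (forall s t, A s -> A t ->
     ((fun n => Jn n s t) : nat -> R[i]^o) @ \oo --> (J s t : R[i]^o)) ->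
  posdef_on A J.
Proof.
move=> JnA JnJ n c s As.
apply: (@cvg_complex_ge0 _ (fun k => \sum_(a < n) \sum_(b < n)
   Num.conj (c a) * c b * Jn k (s a) (s b))) => [k|]; first exact: JnA.
apply: cvg_complex_sum => a; apply: cvg_complex_sum => b.
by apply: cvgM; [exact: cvg_cst|exact: JnJ].
Qed.

(** * The limit kernel of the iterated pullback *)

Section pullback.
Variables (R : realType) (X : Type) (m : nat) (phi : 'I_m.+1 -> X -> X).

Lemma posdef_pullback (J : X -> X -> R[i]) : posdef J -> posdef (pullback phi J).
Proof.
move=> J0 n c s _; rewrite /pullback.
under eq_bigr do (under eq_bigr do rewrite mulr_sumr; rewrite exchange_big/=).
by rewrite exchange_big/=; apply: sumr_ge0 => i _; exact: J0.
Qed.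

Variable K : X -> X -> R[i].
Hypotheses (K_posdef : posdef K) (K_le : kernel_le K (pullback phi K)).

Lemma Kseq_posdef n : posdef (Kseq phi K n).
Proof. by elim: n => //= n IH; exact: posdef_pullback. Qed.

(** L is linear and preserves positivity, hence K_(n+2) - K_(n+1) is the
    pullback of K_(n+1) - K_n. *)
Lemma Kseq_le n : kernel_le (Kseq phi K n) (Kseq phi K n.+1).
Proof.
elim: n => //= n /posdef_pullback.
rewrite /kernel_le; congr posdef; apply/funext => s; apply/funext => t.
by rewrite /pullback -sumrB.
Qed.

Lemma useq_ge0 n s : 0 <= useq phi K n s.
Proof.
have := posdef_on_ge0 (s := s) (Kseq_posdef n) I.
by rewrite lecE => /andP[].
Qed.

Lemma useq_nd s : nondecreasing_seq (useq phi K ^~ s).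
Proof.
apply/nondecreasing_seqP => n; have := posdef_on_ge0 (s := s) (Kseq_le n) I.
by rewrite lecE => /andP[_]; rewrite raddfB subr_ge0.
Qed.

Lemma useq_le_uinf n s : ((useq phi K n s)%:E <= uinf phi K s)%E.
Proof.
have nd : {homo (fun n => (useq phi K n s)%:E) : p q / (p <= q)%N >-> (p <= q)%E}.
  by move=> p q pq; rewrite lee_fin useq_nd.
apply: lime_ge; first exact: ereal_nondecreasing_is_cvgn.
by exists n => // k /= nk; exact: nd.
Qed.

(** For a nondecreasing sequence, having a finite limit is being bounded,
    which is easier to transport along the maps. *)
Lemma XfinP s : Xfin phi K s <-> exists B, forall n, useq phi K n s <= B.
Proof.
split=> [sfin|[B uB]].
  exists (fine (uinf phi K s)) => n; rewrite -lee_fin fineK ?useq_le_uinf//.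
  rewrite ge0_fin_numE//; apply: le_trans (useq_le_uinf 0 s).
  by rewrite lee_fin useq_ge0.
rewrite /Xfin /=; apply: (@le_lt_trans _ _ B%:E); last exact: ltry.
apply: lime_le.
  by apply: ereal_nondecreasing_is_cvgn => p q pq; rewrite lee_fin useq_nd.
by near=> n; rewrite lee_fin.
Unshelve. all: by end_near. Qed.

(** u_n(phi_i(s)) is one of the nonnegative terms of u_(n+1)(s). *)
Lemma Xfin_phi i s : Xfin phi K s -> Xfin phi K (phi i s).
Proof.
move=> /XfinP[B uB]; apply/XfinP; exists B => n; apply: le_trans (uB n.+1).
rewrite /useq /= /pullback raddf_sum /= (bigD1 i)//= lerDl.
by apply: sumr_ge0 => j _; exact: useq_ge0.
Qed.

Lemma Xfin_phi_word w s : Xfin phi K s -> Xfin phi K (phi_word phi w s).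
Proof. by elim: w s => //= i w IH s /(Xfin_phi i)/IH. Qed.

(** Each coordinate v_n of K_n(s,t) is a multiple of the difference of two
    bounded nondecreasing sequences, u_n(s) + u_n(t) + 2 v_n and
    u_n(s) + u_n(t): polarization for K_(n+1) - K_n gives the monotonicity of
    the former, polarization for K_n its boundedness. *)
Lemma Kseq_cvg s t : Xfin phi K s -> Xfin phi K t ->
  ((fun n => Kseq phi K n s t) : nat -> R[i]^o) @ \oo
    --> (Kinf phi K s t : R[i]^o).
Proof.
move=> /[dup] sfin /XfinP[Bs uBs] /[dup] tfin /XfinP[Bt uBt].
have cvgu x B : (forall n, useq phi K n x <= B) -> cvgn (useq phi K ^~ x).
  move=> uB; apply: nondecreasing_is_cvgn; first exact: useq_nd.
  by exists B => _ [n _ <-].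
have cvgw (v : nat -> R) :
    (forall n, `|v n.+1 - v n| <= ((useq phi K n.+1 s - useq phi K n s) +
                                   (useq phi K n.+1 t - useq phi K n t)) / 2) ->
    (forall n, `|v n| <= (useq phi K n s + useq phi K n t) / 2) ->
    cvgn v.
  move=> dv vB.
  pose a n := useq phi K n s + useq phi K n t + 2 * v n.
  have cvga : cvgn a.
    apply: nondecreasing_is_cvgn.
      apply/nondecreasing_seqP => n; rewrite /a.
      by have := dv n; rewrite ler_norml; lra.
    exists (2 * (Bs + Bt)) => _ [n _ <-]; rewrite /a.
    have := vB n; rewrite ler_norml.
    by have := uBs n; have := uBt n; lra.
  have -> : v = (fun n => 2^-1 * (a n - useq phi K n s - useq phi K n t)).
    by apply/funext => n; rewrite /a; lra.
  apply: is_cvgM; first exact: is_cvg_cst.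
  apply: is_cvgB; last exact: cvgu uBt.
  by apply: is_cvgB => //; exact: cvgu uBs.
apply/cvg_ex; exists (limn (fun n => complex.Re (Kseq phi K n s t)) +i*
                      limn (fun n => complex.Im (Kseq phi K n s t)))%C.
apply/cvg_complexE; split => /=.
  apply: cvgw => n; last first.
    by have [] := @posdef_on_polar _ _ _ _ s t (Kseq_posdef n) I I.
  by have [+ _] := @posdef_on_polar _ _ _ _ s t (Kseq_le n) I I;
    rewrite !raddfB.
apply: cvgw => n; last first.
  by have [] := @posdef_on_polar _ _ _ _ s t (Kseq_posdef n) I I.
by have [_] := @posdef_on_polar _ _ _ _ s t (Kseq_le n) I I;
  rewrite !raddfB.
Qed.

Lemma Kinf_posdef : posdef_on (Xfin phi K) (Kinf phi K).
Proof.
apply: (@posdef_on_lim _ _ _ (Kseq phi K)); last exact: Kseq_cvg.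
by move=> n k c s _; exact: Kseq_posdef.
Qed.

Lemma Mseq_posdef n w :
  posdef_on (Xfin phi K) (fun s t => Mseq phi K n s t w).
Proof.
move=> k c s sfin; rewrite /Mseq.
under eq_bigr do (under eq_bigr do rewrite mulrCA; rewrite -mulr_sumr).
rewrite -mulr_sumr mulr_ge0 ?exprn_ge0//.
by apply: (@Kinf_posdef k c (fun a => phi_word phi (mkseq w n) (s a))) => a;
  exact: Xfin_phi_word.
Qed.

End pullback.

(** * Integration against a weight with values in [0, +oo] *)

Section weighted.
Context d (T : measurableType d) (R : realType) (mu : {measure set T -> \bar R}).

Lemma ge0_ae_integrable (V : T -> \bar R) :
  measurable_fun setT V -> {ae mu, forall w, (0 <= V w)%E} ->
  (\int[mu]_w V w < +oo)%E -> mu.-integrable setT V.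
Proof.
move=> mV V0 Voo; apply/integrableP; split => //.
rewrite (ae_eq_integral V)//; first exact: measurableT_comp.
by move: V0; apply: filterS => w V0 _; rewrite gee0_abs.
Qed.

(** If f h1 and f h2 are integrable then, almost everywhere, h1 = h2 = 0 where
    f = +oo; a function V dominated by h1 + h2 vanishes there too. Since
    [fine +oo] is 0, both f V and (fine f) V are then 0, so that the infinite
    values of f do not contribute. *)
Lemma dominated_weight (f : T -> \bar R) (h1 h2 V : T -> R) :
  measurable_fun setT f -> (forall w, 0 <= f w)%E -> measurable_fun setT V ->
  mu.-integrable setT (fun w => f w * (h1 w)%:E)%E ->
  mu.-integrable setT (fun w => f w * (h2 w)%:E)%E ->
  {ae mu, forall w, [/\ 0 <= h1 w, 0 <= h2 w & `|V w| <= (h1 w + h2 w) / 2]} ->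
  mu.-integrable setT (fun w => (fine (f w))%:E * (V w)%:E)%E /\
  (\int[mu]_w (f w * (V w)%:E) = \int[mu]_w ((fine (f w))%:E * (V w)%:E))%E.
Proof.
move=> mf f0 mV i1 i2 hV.
have mg : measurable_fun setT (fun w => (fine (f w))%:E * (V w)%:E)%E.
  by apply: emeasurable_funM; apply/measurable_EFinP => //;
    exact: measurableT_comp.
have good : {ae mu, forall w, f w * (V w)%:E = (fine (f w))%:E * (V w)%:E /\
    `|(fine (f w))%:E * (V w)%:E| <= f w * (h1 w)%:E + f w * (h2 w)%:E}%E.
  have := integrable_ae measurableT i1; have := integrable_ae measurableT i2.
  move: hV; apply: filterS3 => w [h10 h20 hV] /(_ I) f2 /(_ I) f1.
  have := f0 w; case: (f w) f1 f2 => [r| |]//= f1 f2; rewrite ?lee_fin => r0.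
    split=> //; rewrite normrM (ger0_norm r0) -mulrDr.
    by rewrite ler_wpM2l//; apply: (le_trans hV); lra.
  (* Here f w = +oo, and finiteness of f h1 and f h2 forces h1 = h2 = 0. *)
  have z (h : R) : 0 <= h -> (+oo * h%:E)%E \is a fin_num -> h = 0.
    rewrite le_eqVlt => /predU1P[<-//|h0].
    by rewrite gt0_mulye ?lte_fin.
  move: hV; rewrite (z _ h10 f1) (z _ h20 f2) addr0 mul0r.
  rewrite normr_le0 => /eqP ->.
  by rewrite !mule0 mulr0 normr0 adde0.
have mfV : measurable_fun setT (fun w => f w * (V w)%:E)%E.
  by apply: emeasurable_funM => //; exact/measurable_EFinP.
split; last first.
  by apply: ae_eq_integral => //; move: good; apply: filterS => w [].
apply/integrableP; split => //.
have /integrableP[m12 i12] := integrableD measurableT i1 i2.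
apply: le_lt_trans i12; apply: ae_ge0_le_integral => //.
- exact: measurableT_comp.
- exact: measurableT_comp.
- move: good; apply: filterS => w [_ h] _; apply: (le_trans h).
  exact: lee_abs.
Qed.

End weighted.

Section complex_weighted.
Context (R : realType) (m : nat) (mu : probability (Omega m) R).
Variable g : Omega m -> R.
Local Notation CI := (complex_integral mu (EFin \o g)).

(** The products are written in \bar R to match the integrands of
    [complex_integral], although the weight g is finite. *)
Definition weighted_integrable (F : Omega m -> R[i]) : Prop :=
  mu.-integrable setT (fun w => (g w)%:E * (complex.Re (F w))%:E)%E /\
  mu.-integrable setT (fun w => (g w)%:E * (complex.Im (F w))%:E)%E.

Lemma weighted_lin (z : R[i]) (F G : Omega m -> R[i]) :
  weighted_integrable F -> weighted_integrable G ->
  weighted_integrable (fun w => z * F w + G w) /\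
  CI (fun w => z * F w + G w) = z * CI F + CI G.
Proof.
move=> [F1 F2] [G1 G2]; case: z => x y.
have ZF c (V : Omega m -> R) :
    mu.-integrable setT (fun w => (g w)%:E * (V w)%:E)%E ->
    mu.-integrable setT (EFin \o (fun w => c * (g w * V w))).
  by move=> /(integrableZl measurableT c).
have DF (V W : Omega m -> R) : mu.-integrable setT (EFin \o V) ->
    mu.-integrable setT (EFin \o W) ->
    mu.-integrable setT (EFin \o (fun w => V w + W w)).
  exact: integrableD.
have reE : (fun w => (g w)%:E * (complex.Re ((x +i* y)%C * F w + G w))%:E)%E =
  EFin \o (fun w => x * (g w * complex.Re (F w)) +
    (- y) * (g w * complex.Im (F w)) + g w * complex.Re (G w)).
  apply/funext => w /=; rewrite -EFinM; congr EFin.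
  by case: (F w) (G w) => [a b] [c e] /=; ring.
have imE : (fun w => (g w)%:E * (complex.Im ((x +i* y)%C * F w + G w))%:E)%E =
  EFin \o (fun w => x * (g w * complex.Im (F w)) +
    y * (g w * complex.Re (F w)) + g w * complex.Im (G w)).
  apply/funext => w /=; rewrite -EFinM; congr EFin.
  by case: (F w) (G w) => [a b] [c e] /=; ring.
split.
  rewrite /weighted_integrable reE imE.
  by split; do ![exact: ZF | exact: G1 | exact: G2 | apply: (DF _ _)].
rewrite /complex_integral /= reE imE.
rewrite [fine _](_ : _ = \int[mu]_w (x * (g w * complex.Re (F w)) +
    (- y) * (g w * complex.Im (F w)) + g w * complex.Re (G w)))//.
rewrite [X in (_ +i* X)%C = _](_ : _ = \int[mu]_w (x * (g w * complex.Im (F w)) +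
    y * (g w * complex.Re (F w)) + g w * complex.Im (G w)))//.
rewrite !RintegralD//; do ?[exact: ZF | exact: G1 | exact: G2 | apply: (DF _ _)].
by rewrite !RintegralZl//; congr Complex; rewrite /Rintegral/= ?mulNr.
Qed.

Lemma weighted_sum (I : Type) (r : seq I) (k : I -> R[i]) (F : I -> Omega m -> R[i]) :
  (forall i, weighted_integrable (F i)) ->
  weighted_integrable (fun w => \sum_(i <- r) k i * F i w) /\
  CI (fun w => \sum_(i <- r) k i * F i w) = \sum_(i <- r) k i * CI (F i).
Proof.
move=> iF; elim: r => [|i r [IH1 IH2]].
  under eq_fun do rewrite big_nil; rewrite big_nil.
  rewrite /weighted_integrable /complex_integral /=.
  have -> : (fun w : Omega m => (g w)%:E * 0%:E)%E = cst 0%E.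
    by apply/funext => w; rewrite mule0.
  by rewrite integral0; split => //; split; exact: integrable0.
under eq_fun do rewrite big_cons.
by rewrite big_cons -IH2; exact: weighted_lin.
Qed.

Lemma weighted_ge0 (F : Omega m -> R[i]) : (forall w, 0 <= g w) ->
  weighted_integrable F -> {ae mu, forall w, 0 <= F w} -> 0 <= CI F.
Proof.
move=> g0 [/integrableP[mre _] /integrableP[mim _]] F0.
rewrite lecE /=; apply/andP; split.
  rewrite (ae_eq_integral (cst 0%E))//= ?integral0//.
  by move: F0; apply: filterS => w /ger0_Im -> _; rewrite mule0.
rewrite (ae_eq_integral (fun w => `|(g w)%:E * (complex.Re (F w))%:E|%E))//.
- by apply: fine_ge0; exact: integral_ge0.
- exact: measurableT_comp.
- move: F0; apply: filterS => w; rewrite lecE => /andP[_ F0] _.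
  by rewrite gee0_abs// mule_ge0 ?lee_fin.
Qed.

End complex_weighted.

(** The quadratic form of the integrated kernel is the integral of the
    pointwise quadratic forms. This needs all entries, and not only the
    diagonal ones, to be integrable against f: polarization dominates an
    entry by the two diagonal entries in its row and its column. *)
Lemma posdef_complex_integral (R : realType) (m : nat)
    (mu : probability (Omega m) R) (f : Omega m -> \bar R) (n : nat)
    (F : 'I_n -> 'I_n -> Omega m -> R[i]) :
  measurable_fun setT f -> (forall w, 0 <= f w)%E ->
  (forall a b, measurable_complex (F a b)) ->
  {ae mu, forall w, posdef (fun a b => F a b w)} ->
  (forall a, \int[mu]_w (f w * (complex.Re (F a a w))%:E) < +oo)%E ->
  posdef (fun a b => complex_integral mu f (F a b)).
Proof.
move=> mf f0 mF F0 Foo.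
have iF a : mu.-integrable setT (fun w => f w * (complex.Re (F a a w))%:E)%E.
  apply: ge0_ae_integrable => //.
    by apply: emeasurable_funM => //; apply/measurable_EFinP; have [] := mF a a.
  move: F0; apply: filterS => w F0; rewrite mule_ge0// lee_fin.
  by have := posdef_on_ge0 F0 (I : setT a); rewrite lecE => /andP[].
pose g w := fine (f w).
have dom a b : weighted_integrable mu g (F a b) /\
    complex_integral mu f (F a b) = complex_integral mu (EFin \o g) (F a b).
  have [mre mim] := mF a b.
  have diag0 (x : 'I_n) w : posdef (fun a b => F a b w) ->
      0 <= complex.Re (F x x w).
    move=> Fw; have := posdef_on_ge0 Fw (I : setT x).
    by rewrite lecE => /andP[].
  have [|re1 re2] := dominated_weight mf f0 mre (iF a) (iF b).
    move: F0; apply: filterS => w F0; split; [exact: diag0..|].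
    by have [] := posdef_on_polar F0 (I : setT a) (I : setT b).
  have [|im1 im2] := dominated_weight mf f0 mim (iF a) (iF b).
    move: F0; apply: filterS => w F0; split; [exact: diag0..|].
    by have [] := posdef_on_polar F0 (I : setT a) (I : setT b).
  by split; [split|rewrite /complex_integral re2 im2].
move=> k c s _.
have [iS] := weighted_sum (index_enum ('I_k * 'I_k)%type)
  (fun p => Num.conj (c p.1) * c p.2) (fun p => (dom (s p.1) (s p.2)).1).
under [RHS]eq_bigr do rewrite -(dom _ _).2.
rewrite pair_big/= => <-; apply: weighted_ge0 => // [w|].
  exact: fine_ge0.
move: F0; apply: filterS => w F0.
by have := F0 k c s (fun=> I); rewrite pair_big.
Qed.

(** * Integrating the limit of the martingale *)

(** The exceptional set depends on the points s_a, which is harmless since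
    there are finitely many of them; it does not depend on the coefficients of
    the quadratic form. *)
Lemma Minf_posdef (R : realType) (X : Type) (m : nat)
    (phi : 'I_m.+1 -> X -> X) (K : X -> X -> R[i])
    (mu : probability (Omega m) R) (Minf : X -> X -> Omega m -> R[i])
    (n : nat) (s : 'I_n -> X) :
  posdef K -> kernel_le K (pullback phi K) ->
  is_limit_version phi K mu Minf -> (forall a, X2 phi K (s a)) ->
  {ae mu, forall w, posdef (fun a b => Minf (s a) (s b) w)}.
Proof.
move=> K0 KL [Mlim _] s2.
have : {ae mu, forall w : Omega m, forall a b,
    ((fun n => Mseq phi K n (s a) (s b) w) : nat -> R[i]^o) @ \oo
      --> (Minf (s a) (s b) w : R[i]^o)}.
  apply: filter_forall => a; apply: filter_forall => b.
  by have [_ _ _] := Mlim _ _ (s2 a) (s2 b).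
apply: filterS => w Mw.
apply: (@posdef_on_lim _ _ _ (fun n a b => Mseq phi K n (s a) (s b) w)) => //.
move=> k; apply: ((posdef_on_ord _ _).1 (Mseq_posdef K0 KL k w)) => a.
by have [] := s2 a.
Qed.

End proof.

Theorem theorem7p2 (R : realType) (X : Type) (m : nat)
    (phi : 'I_m.+1 -> X -> X) (K : X -> X -> R[i])
    (K_posdef : posdef K)
    (K_le : kernel_le K (pullback phi K))
    (mu : probability (Omega m) R)
    (mu_prod : is_uniform_product mu)
    (Minf : X -> X -> Omega m -> R[i])
    (Minf_lim : is_limit_version phi K mu Minf)
    (f : Omega m -> \bar R)
    (f_meas : measurable_fun [set: Omega m] f)
    (f_ge0 : forall w, (0 <= f w)%E) :
  posdef_on (Xf phi K mu Minf f) (Jf mu Minf f) /\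
  (forall (r : nat) (s : 'I_r -> X), (0 < r)%N ->
    (forall i, Xf phi K mu Minf f (s i)) ->
    psdmx (\matrix_(i < r, j < r) Jf mu Minf f (s i) (s j))).
Proof.
have Jpd : posdef_on (Xf phi K mu Minf f) (Jf mu Minf f).
  apply/posdef_on_ord => n s sf.
  have s2 a : X2 phi K (s a) by have [] := sf a.
  apply: (@posdef_complex_integral _ _ mu f n (fun a b => Minf (s a) (s b))) => //.
  - by move=> a b; have [+ _ _ _] := Minf_lim.1 _ _ (s2 a) (s2 b).
  - exact: Minf_posdef Minf_lim s2.
  - by move=> a; have [] := sf a.
split=> // r s _ sf; exact: posdef_on_psdmx sf.
Qed.
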